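(* Let $\mathcal{A}$ be a Banach algebra, let $\Psi=\{\psi_t\}_{t\in\mathbb{R}^d}$ be a uniformly bounded $d$-parameter automorphism group acting on $\mathcal{A}$, and let $r>0$. Then the Hölder-Zygmund space $\Lambda_r(\mathcal{A})$ is a Banach subalgebra of $\mathcal{A}$, and $\Lambda_r(\mathcal{A})$ is inverse-closed in $\mathcal{A}$.
   Context: All Banach algebras are complex and unital. A Banach space norm on an algebra satisfying $\|ab\|\le C\|a\|\|b\|$ for some constant $C$ is regarded as a Banach algebra norm (it can be replaced by an equivalent submultiplicative norm). For $\mathcal{A}\subseteq\mathcal{B}$ with common unit, $\mathcal{A}$ is inverse-closed in $\mathcal{B}$ if $a\in\mathcal{A}$, $a^{-1}\in\mathcal{B}$ imply $a^{-1}\in\mathcal{A}$. A uniformly bounded $d$-parameter automorphism group is a family $\Psi=\{\psi_t\}_{t\in\mathbb{R}^d}$ of Banach algebra automorphisms of $\mathcal{A}$ with $\psi_s\psi_t=\psi_{s+t}$ for all $s,t\in\mathbb{R}^d$ and $M_\Psi=\sup_t\|\psi_t\|_{\mathcal{A}\to\mathcal{A}}<\infty$ (no continuity in $t$ is assumed). The set of continuous elements is $C(\mathcal{A})=\{a\in\mathcal{A}:\|\psi_t(a)-a\|_{\mathcal{A}}\to0\text{ as }t\to0\}$. The canonical generators are $\delta_j(a)=\lim_{h\to0}h^{-1}(\psi_{he_j}(a)-a)$ (norm limit), $1\le j\le d$, defined on all $a$ for which the limit exists; $e_j$ is the standard basis. For a multi-index $\alpha$, $\delta^\alpha=\delta_1^{\alpha_1}\cdots\delta_d^{\alpha_d}$,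 and $\mathcal{D}(\delta^\alpha,C(\mathcal{A}))$ is the set of $a\in C(\mathcal{A})$ for which the iterated expression $\delta^\alpha(a)$ is defined (with all intermediate elements in $C(\mathcal{A})$). $C^k(\mathcal{A})=\bigcap_{|\alpha|\le k}\mathcal{D}(\delta^\alpha,C(\mathcal{A}))$ (independent of the order of the generators), with norm $\|a\|_{C^k(\mathcal{A})}=\sum_{|\alpha|\le k}\frac1{\alpha!}\|\delta^\alpha a\|_{\mathcal{A}}$, and $C^0(\mathcal{A})=C(\mathcal{A})$. Finite differences: $\Delta_ta=\psi_t(a)-a$, $\Delta_t^2a=\Delta_t\Delta_ta$. For $0<\eta\le1$, $|a|_{\Lambda_\eta}=\sup_{t\ne0}|t|^{-\eta}\|\Delta_t^2a\|_{\mathcal{A}}$, where $|t|$ is the $1$-norm. For $r=k+\eta$ with $k\in\mathbb{N}_0$, $0<\eta\le1$, $\Lambda_r(\mathcal{A})$ is the space of all $a\in C^k(\mathcal{A})$ with $\|a\|_{\Lambda_r(\mathcal{A})}=\|a\|_{C^k(\mathcal{A})}+\sum_{|\alpha|=k}|\delta^\alpha(a)|_{\Lambda_\eta}<\infty$. *)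

(* Defs.v *)
From HB Require Import structures.
From mathcomp Require Import all_boot all_order all_algebra.
From mathcomp Require Import complex.
From mathcomp Require Import all_classical all_reals all_analysis.

Set Implicit Arguments.
Unset Strict Implicit.
Unset Printing Implicit Defensive.

Import Order.TTheory GRing.Theory Num.Theory.
Import numFieldNormedType.Exports.

Local Open Scope classical_set_scope.
Local Open Scope complex_scope.
Local Open Scope ring_scope.

(* MathComp-Analysis has no normed algebras, and its [completeNormedModType]
   cannot be joined with [algType] (Hierarchy Builder already takes
   [numDomainType] as the join of rings and normed groups). Hence the norm is an
   explicit real-valued function on an [algType R[i]]; the latter provides the
   unit and the convention 1 != 0. *)

Section BanachNorms.
Context {R : realType} {A : algType R[i]}.
Implicit Types (a b : A) (S : set A) (N : A -> R).

(* Below, [N] only matters on the subalgebra [S]. *)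
Record norm_on S N : Prop := NormOn {
  norm_on_ge0 : forall a, S a -> 0 <= N a;
  norm_on_eq0 : forall a, S a -> N a = 0 -> a = 0;
  norm_onD : forall a b, S a -> S b -> N (a + b) <= N a + N b;
  norm_onZ : forall (c : R[i]) a, S a -> N (c *: a) = Normc.normc c * N a
}.

Definition cauchy_on N (u : nat -> A) : Prop :=
  forall e : R, 0 < e ->
    exists n0 : nat, forall m n, (n0 <= m)%N -> (n0 <= n)%N -> N (u m - u n) < e.

Definition complete_on S N : Prop :=
  forall u : nat -> A, (forall n, S (u n)) -> cauchy_on N u ->
    exists2 l, S l & N (u n - l) @[n --> \oo] --> (0 : R).

(* A complete norm with |ab| <= C |a| |b| for some constant C counts as a
   Banach algebra norm; it is equivalent to a submultiplicative one. *)
Record banach_norm_on S N : Prop := BanachNormOn {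
  banach_norm_norm : norm_on S N;
  banach_norm_complete : complete_on S N;
  banach_normM : exists C : R, forall a b, S a -> S b -> N (a * b) <= C * N a * N b
}.

End BanachNorms.

Record banachAlg (R : realType) := BanachAlg {
  banach_sort :> algType R[i];
  bnorm : banach_sort -> R;
  banach_normP : banach_norm_on [set: banach_sort] bnorm
}.

(* [GRing.subalg_closed] includes the common unit; the last field says that [S]
   is continuously embedded. *)
Record banach_subalgebra {R : realType} {A : banachAlg R}
    (S : set A) (N : A -> R) : Prop := BanachSubalgebra {
  bsub_subalg : GRing.subalg_closed (mem S);
  bsub_norm : banach_norm_on S N;
  bsub_embed : exists C : R, forall a, S a -> bnorm a <= C * N a
}.

Definition inverse_closed {R : realType} {A : banachAlg R} (S : set A) : Prop :=
  forall a b : A, S a -> a * b = 1 -> b * a = 1 -> S b.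

(* The algebra homomorphism laws are part of the type of [psi]; the uniform
   bound makes every [psi t] continuous. No continuity in [t] is required. *)
Record bounded_automorphism_group {R : realType} {A : banachAlg R}
    {d : nat} (psi : 'rV[R]_d -> {lrmorphism A -> A}) : Prop :=
  BoundedAutomorphismGroup {
    autgrp_bij : forall t, bijective (psi t);
    autgrpD : forall s t a, psi s (psi t a) = psi (s + t) a;
    autgrp_bounded : exists M : R, forall t a, bnorm (psi t a) <= M * bnorm a
  }.

Section HolderZygmund.
Context {R : realType} {A : banachAlg R} {d : nat}.
Variable psi : 'rV[R]_d -> {lrmorphism A -> A}.
Implicit Types (a b : A) (t : 'rV[R]_d) (j : 'I_d) (k : nat).

Definition cont_elt : set A :=
  [set a | bnorm (psi t a - a) @[t --> (0 : 'rV[R]_d)] --> (0 : R)].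

Definition diff_quot j a (h : R) : A :=
  (h^-1)%:C *: (psi (h *: delta_mx 0 j) a - a).

Definition is_gen j a b : Prop :=
  bnorm (diff_quot j a h - b) @[h --> 0^'] --> (0 : R).

Definition gen_dom j : set A := [set a | exists b, is_gen j a b].

(* Meaningful on [gen_dom j] only, where the limit is unique. *)
Definition gen j a : A := xget 0 (is_gen j a).

(* For w = [:: j1; ...; jn], the composition gen j1 \o ... \o gen jn. *)
Definition gen_word (w : seq 'I_d) a : A := foldr gen a w.

Fixpoint gen_word_dom (w : seq 'I_d) : set A :=
  if w is j :: w' then
    [set a | [/\ gen_word_dom w' a, gen_dom j (gen_word w' a)
               & cont_elt (gen_word (j :: w') a)]]
  else cont_elt.

Definition mi_word (al : 'I_d -> nat) : seq 'I_d :=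
  flatten [seq nseq (al j) j | j <- enum 'I_d].

Definition gen_mi (al : 'I_d -> nat) : A -> A := gen_word (mi_word al).

Definition gen_mi_dom (al : 'I_d -> nat) : set A := gen_word_dom (mi_word al).

Definition mi_abs (al : 'I_d -> nat) : nat := (\sum_j al j)%N.

Definition mi_fact (al : 'I_d -> nat) : nat := (\prod_j (al j)`!)%N.

Definition Ck k : set A :=
  [set a | forall al : 'I_d -> nat, (mi_abs al <= k)%N -> gen_mi_dom al a].

(* A multi-index of length at most k has all its entries in 'I_k.+1. *)
Definition mi_val n (al : {ffun 'I_d -> 'I_n}) : 'I_d -> nat := fun j => al j.

Definition Ck_norm k a : R :=
  \sum_(al : {ffun 'I_d -> 'I_k.+1} | (mi_abs (mi_val al) <= k)%N)
    (mi_fact (mi_val al))%:R^-1 * bnorm (gen_mi (mi_val al) a).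

Definition Delta t a : A := psi t a - a.

Definition norm1 t : R := \sum_j `|t 0 j|.

Definition zyg_seminorm (eta : R) a : \bar R :=
  ereal_sup [set (norm1 t `^ (- eta) * bnorm (Delta t (Delta t a)))%:E
            | t in [set t | t != 0]].

(* The decomposition r = k + eta with k : nat and 0 < eta <= 1. *)
Definition zyg_order (r : R) : nat := (absz (Num.ceil r)).-1.

Definition zyg_frac (r : R) : R := r - (zyg_order r)%:R.

Definition Lambda_enorm (r : R) a : \bar R :=
  ((Ck_norm (zyg_order r) a)%:E +
   \sum_(al : {ffun 'I_d -> 'I_(zyg_order r).+1} | mi_abs (mi_val al) == zyg_order r)
     zyg_seminorm (zyg_frac r) (gen_mi (mi_val al) a))%E.

Definition Lambda (r : R) : set A :=
  [set a | Ck (zyg_order r) a /\ (Lambda_enorm r a < +oo)%E].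

Definition Lambda_norm (r : R) a : R := fine (Lambda_enorm r a).

End HolderZygmund.

Lemma zyg_frac_itv {R : realType} (r : R) : 0 < r -> 0 < zyg_frac r <= 1.
Proof.
move=> r0; rewrite /zyg_frac /zyg_order.
have c0 : (0 < Num.ceil r)%R by rewrite ceil_gt0.
case E: (Num.ceil r) c0 => [[//|n]|n] //= _.
have /andP[h1 h2] := ceil_itv r.
rewrite E in h1 h2.
rewrite subr_gt0 lerBlDl; apply/andP; split.
  apply: le_lt_trans h1.
  by rewrite /= intS addrC addKr.
by rewrite natr1.
Qed.

Lemma zyg_decomp_uniq {R : realType} (k : nat) (eta : R) : 0 < eta <= 1 ->
  zyg_order (k%:R + eta) = k /\ zyg_frac (k%:R + eta) = eta.
Proof.
move=> /andP[e0 e1].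
have E : Num.ceil (k%:R + eta) = k.+1%:Z.
  apply/ceil_def; rewrite intS addrC addKr /=; apply/andP; split.
    by rewrite -[X in X < _]addr0 ltrD2l.
  by rewrite -[X in _ <= X]/(k.+1%:R) -natr1 lerD2l.
by rewrite /zyg_frac /zyg_order E /= [_ + eta]addrC addrK.
Qed.

(* Main.v *)
(* A word of generators is defined on a product or an inverse by the Leibniz
   rule, so everything is proved by induction on the smoothness k, provided that
   all generators preserve the scale: delta_i maps Lambda_(k+1+eta) to
   Lambda_(k+eta) for every i. Since C^k only asks for derivatives in one order,
   this rests on the commutation of the generators, which follows from their
   closedness; both come from a mean value inequality proved by telescoping.

   For k = 0 the only obstacle is the cross term in
     D_t^2 (ab) = D_t^2 a . psi_t^2 b + 2 D_t a . psi_t (D_t b) + a . D_t^2 b,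
   which is O(|t|^eta) because Marchaud's inequality bounds D_t a by |t|^(eta/2).
   With ab = 1 the left-hand side vanishes and the identity can be solved for
   D_t^2 b.

   Norm estimates are phrased with balls: [hz_ball k X a] bounds all derivatives
   of [a] by [X], and is comparable to [Lambda_norm a <= X]. *)
Require Import Defs.
From mathcomp Require Import all_boot all_order all_algebra.
From mathcomp Require Import complex.
From mathcomp Require Import all_classical all_reals all_analysis.
From mathcomp Require Import ring lra.

Set Implicit Arguments.
Unset Strict Implicit.
Unset Printing Implicit Defensive.

Import Order.TTheory GRing.Theory Num.Theory.
Import numFieldNormedType.Exports.
Local Open Scope classical_set_scope.
Local Open Scope complex_scope.
Local Open Scope ring_scope.

(** * Null limits of nonnegative functions along a filter *)

Section NullFilter.
Context {R : realType} {T : Type} {F : set_system T} {FF : Filter F}.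
Implicit Types f g : T -> R.

Lemma cvg0_leP f : (forall x, 0 <= f x) ->
  (f x @[x --> F] --> (0 : R)) <-> (forall e, 0 < e -> \forall x \near F, f x <= e).
Proof.
move=> f0; split=> [/cvgr0Pnorm_le h e e0|h].
  by near=> x; rewrite -[f x]ger0_norm//; near: x; exact: h.
apply/cvgr0Pnorm_le => e e0; near=> x; rewrite ger0_norm//.
by near: x; exact: h.
Unshelve. all: by end_near. Qed.

Lemma cvg0_squeeze f g : (forall x, 0 <= f x) -> (forall x, f x <= g x) ->
  g x @[x --> F] --> (0 : R) -> f x @[x --> F] --> (0 : R).
Proof.
move=> f0 fg g0; apply: (squeeze_cvgr _ (cvg_cst 0) g0).
by near=> x; rewrite f0 fg.
Unshelve. all: by end_near. Qed.

Lemma cvg0D f g : f x @[x --> F] --> (0 : R) -> g x @[x --> F] --> (0 : R) ->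
  f x + g x @[x --> F] --> (0 : R).
Proof. by move=> f0 g0; rewrite -[X in _ --> X]addr0; exact: cvgD. Qed.

Lemma cvg0Z (c : R) f : f x @[x --> F] --> (0 : R) ->
  c * f x @[x --> F] --> (0 : R).
Proof. by move=> f0; rewrite -[X in _ --> X](mulr0 c); exact: cvgMl_tmp. Qed.

End NullFilter.

(** * Elementary estimates for the Banach algebra norm *)

Section BanachNorm.
Context {R : realType} {A : banachAlg R}.
Implicit Types (a b : A) (x : R).

Lemma bnorm_ge0 a : 0 <= bnorm a.
Proof. by have [[h _ _ _] _ _] := banach_normP A; exact: h. Qed.

Lemma bnorm_eq0 a : bnorm a = 0 -> a = 0.
Proof. by have [[_ h _ _] _ _] := banach_normP A; exact: h. Qed.

Lemma bnormD a b : bnorm (a + b) <= bnorm a + bnorm b.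
Proof. by have [[_ _ h _] _ _] := banach_normP A; exact: h. Qed.

Lemma bnormZ (c : R[i]) a : bnorm (c *: a) = Normc.normc c * bnorm a.
Proof. by have [[_ _ _ h] _ _] := banach_normP A; exact: h. Qed.

Lemma normc_real x : Normc.normc x%:C = `|x|.
Proof. by rewrite /Normc.normc /= expr0n addr0 sqrtr_sqr. Qed.

Lemma normc_ge0 (c : R[i]) : 0 <= Normc.normc c.
Proof. by case: c => u v; exact: sqrtr_ge0. Qed.

Lemma bnormZr x a : bnorm (x%:C *: a) = `|x| * bnorm a.
Proof. by rewrite bnormZ normc_real. Qed.

Lemma bnorm0 : bnorm (0 : A) = 0.
Proof. by rewrite -(scale0r (0 : A)) bnormZ Normc.normc0 mul0r. Qed.

Lemma bnormN a : bnorm (- a) = bnorm a.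
Proof.
have -> : - a = (-1 : R)%:C *: a by rewrite rmorphN1 scaleN1r.
by rewrite bnormZr normrN1 mul1r.
Qed.

Lemma bnormB a b : bnorm (a - b) <= bnorm a + bnorm b.
Proof. by rewrite -(bnormN b) bnormD. Qed.

Lemma bnorm_sum (I : Type) (s : seq I) (P : pred I) (f : I -> A) :
  bnorm (\sum_(i <- s | P i) f i) <= \sum_(i <- s | P i) bnorm (f i).
Proof.
elim/big_rec2: _ => [|i y1 y2 _ h]; first by rewrite bnorm0.
by apply: le_trans (bnormD _ _) _; rewrite lerD2l.
Qed.

(** Enlarging the constant to [|C| + 1] makes it positive, so that bounds can be multiplied by
    it. *)
Lemma bnormM_ex : exists2 C : R, 1 <= C &
  forall a b, bnorm (a * b) <= C * bnorm a * bnorm b.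
Proof.
have [_ _ [C h]] := banach_normP A; exists (`|C| + 1); first by rewrite lerDr.
move=> a b; apply: le_trans (h a b I I) _.
rewrite -!mulrA ler_wpM2r ?mulr_ge0 ?bnorm_ge0//.
by rewrite (le_trans (ler_norm _)) ?lerDl.
Qed.

Lemma bnorm_complete (u : nat -> A) : cauchy_on (@bnorm R A) u ->
  exists l, bnorm (u n - l) @[n --> \oo] --> (0 : R).
Proof.
have [_ h _] := banach_normP A => /(h u (fun=> I))[l _ hl].
by exists l.
Qed.

End BanachNorm.

Section AutomorphismGroup.
Context {R : realType} {A : banachAlg R} {d : nat}.
Variable psi : 'rV[R]_d -> {lrmorphism A -> A}.
Hypothesis psiD : forall s t a, psi s (psi t a) = psi (s + t) a.
Hypothesis psi_inj : forall t, injective (psi t).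
Variable M : R.
Hypothesis M1 : 1 <= M.
Hypothesis psiM : forall t a, bnorm (psi t a) <= M * bnorm a.
Variable C : R.
Hypothesis C1 : 1 <= C.
Hypothesis normM : forall a b : A, bnorm (a * b) <= C * bnorm a * bnorm b.
Implicit Types (a b c : A) (t : 'rV[R]_d) (i j : 'I_d) (k n : nat) (h s : R).

Let M0 : 0 <= M. Proof. exact: le_trans ler01 M1. Qed.
Let C0 : 0 <= C. Proof. exact: le_trans ler01 C1. Qed.

Local Notation e j := (delta_mx 0 j : 'rV[R]_d).
Local Notation nn := bnorm_ge0.

(** * Generators *)

(** The group law makes [psi 0] idempotent, and an injective idempotent map is the identity. *)
Lemma psi0 a : psi 0 a = a.
Proof. by apply: (@psi_inj 0); rewrite psiD addr0. Qed.

Lemma psiC (s t : 'rV[R]_d) a : psi s (psi t a) = psi t (psi s a).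
Proof. by rewrite !psiD addrC. Qed.

(** The norm on row vectors is the maximum norm, which defines the neighbourhoods in [cont_elt]; the
    bound turns limits in [t] into limits along an axis. *)
Lemma norm_axis s j : `|s *: e j| <= `|s|.
Proof.
rewrite [leLHS]mx_normrE; apply/bigmax_leP; split=> [|[x y] _] //=.
rewrite !mxE normrM; case: eqP => _; case: eqP => _ /=;
  by rewrite ?normr1 ?normr0 ?mulr1 ?mulr0.
Qed.

Lemma cont_eltP a : cont_elt psi a <->
  (forall x : R, 0 < x -> exists2 r : R, 0 < r &
     forall t, `|t| < r -> bnorm (psi t a - a) <= x).
Proof.
have [h1 h2] := @cvg0_leP R _ (nbhs (0 : 'rV[R]_d)) _ _
  (fun t => nn (psi t a - a)).
split => [/h1 h x x0|h].
  have /nbhs_ballP[r r0 hr] := h x x0.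
  by exists r => // t tr; apply: hr; rewrite -ball_normE /= sub0r normrN.
apply: h2 => x x0.
have [r r0 hr] := h x x0; apply/nbhs_ballP; exists r => //= t.
by rewrite -ball_normE /= sub0r normrN; exact: hr.
Qed.

Lemma is_genP j a b : is_gen psi j a b <->
  (forall x : R, 0 < x -> exists2 r : R, 0 < r &
     forall h, h != 0 -> `|h| < r -> bnorm (diff_quot psi j a h - b) <= x).
Proof.
have [h1 h2] := @cvg0_leP R _ (0 : R)^' _ _
  (fun h => nn (diff_quot psi j a h - b)).
split => [/h1 h x x0|h].
  have /nbhs_ballP[r r0 hr] := h x x0.
  exists r => // t t0 tr; apply: hr; last exact: t0.
  by rewrite -ball_normE /= sub0r normrN.
apply: h2 => x x0.
have [r r0 hr] := h x x0; apply/nbhs_ballP; exists r => //= t.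
by rewrite -ball_normE /= sub0r normrN => tr t0; exact: hr.
Qed.

Lemma cvg_axis j b : cont_elt psi b ->
  bnorm (psi (h *: e j) b - b) @[h --> 0^'] --> (0 : R).
Proof.
move=> /cont_eltP cb; apply/cvg0_leP => [h|x x0]; first exact: nn.
have [r r0 hr] := cb x x0.
near=> h; apply/hr/(le_lt_trans (norm_axis _ _)).
by near: h; exact: dnbhs0_lt.
Unshelve. all: by end_near. Qed.

Lemma is_gen_uniq j a b b' : is_gen psi j a b -> is_gen psi j a b' -> b = b'.
Proof.
move=> hb hb'; apply/eqP; rewrite -subr_eq0; apply/eqP/bnorm_eq0.
have : bnorm (b - b') @[h --> (0 : R)^'] --> (0 : R).
  apply: (cvg0_squeeze _ _ (cvg0D hb hb')) => h; first exact: nn.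
  have -> : b - b' = (diff_quot psi j a h - b') - (diff_quot psi j a h - b).
    by rewrite opprB [RHS]addrC addrA subrK.
  by rewrite [leRHS]addrC bnormB.
move=> h; exact: (norm_cvg_unique (cvg_cst _) h).
Qed.

Lemma is_gen_gen j a b : is_gen psi j a b -> gen psi j a = b.
Proof. by move=> h; apply: (is_gen_uniq _ h); apply: xgetPex; exists b. Qed.

Lemma gen_domP j a : gen_dom psi j a -> is_gen psi j a (gen psi j a).
Proof. exact: xgetPex. Qed.

Lemma is_gen_dom j a b : is_gen psi j a b -> gen_dom psi j a.
Proof. by exists b. Qed.

Lemma diff_quotZD j (c : R[i]) a b h : diff_quot psi j (c *: a + b) h =
  c *: diff_quot psi j a h + diff_quot psi j b h.
Proof.
rewrite /diff_quot linearP scalerA [c * _]mulrC -scalerA -scalerDr.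
rewrite [c *: (_ - _)]scalerBr.
by congr (_ *: _); rewrite opprD addrACA.
Qed.

Lemma diff_quot_psi j t a h :
  diff_quot psi j (psi t a) h = psi t (diff_quot psi j a h).
Proof. by rewrite /diff_quot psiC -linearB /= -linearZ. Qed.

Lemma diff_quotB j a b h :
  diff_quot psi j (a - b) h = diff_quot psi j a h - diff_quot psi j b h.
Proof. by rewrite addrC -scaleN1r diff_quotZD scaleN1r addrC. Qed.

Lemma is_genZD j (c : R[i]) a b a' b' : is_gen psi j a a' -> is_gen psi j b b' ->
  is_gen psi j (c *: a + b) (c *: a' + b').
Proof.
move=> ha hb.
apply: (cvg0_squeeze _ _ (cvg0D (cvg0Z (Normc.normc c) ha) hb)) => h.
  exact: nn.
by rewrite diff_quotZD opprD addrACA -scalerBr -bnormZ bnormD.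
Qed.

Lemma is_gen0 j : is_gen psi j 0 0.
Proof.
apply/is_genP => x x0; exists 1 => // h _ _.
by rewrite /diff_quot linear0 !subr0 scaler0 bnorm0 ltW.
Qed.

Lemma is_genZ j (c : R[i]) a a' : is_gen psi j a a' ->
  is_gen psi j (c *: a) (c *: a').
Proof. by move/(@is_genZD j c a 0 a' 0)/(_ (is_gen0 j)); rewrite !addr0. Qed.

Lemma is_genB j a b a' b' : is_gen psi j a a' -> is_gen psi j b b' ->
  is_gen psi j (a - b) (a' - b').
Proof.
by move=> ha hb; have := is_genZD (-1) hb ha; rewrite !scaleN1r ![- _ + _]addrC.
Qed.

Lemma is_gen1 j : is_gen psi j 1 0.
Proof.
apply/is_genP => x x0; exists 1 => // h _ _.
by rewrite /diff_quot rmorph1 !subrr scaler0 subr0 bnorm0 ltW.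
Qed.

Lemma diff_quotM j a b h : diff_quot psi j (a * b) h =
  diff_quot psi j a h * psi (h *: e j) b + a * diff_quot psi j b h.
Proof.
rewrite /diff_quot rmorphM /= -scalerAl -scalerAr -scalerDr mulrBl mulrBr.
by rewrite addrA subrK.
Qed.

(** The error splits into three terms; the middle one, [a' * (psi (h *: e j) b - b)], is where the
    continuity of [b] enters. *)
Lemma is_genM j a b a' b' : cont_elt psi b ->
  is_gen psi j a a' -> is_gen psi j b b' ->
  is_gen psi j (a * b) (a' * b + a * b').
Proof.
move=> cb ha hb.
apply: (cvg0_squeeze _ _ (cvg0D (cvg0D (cvg0Z (C * (M * bnorm b)) ha)
  (cvg0Z (C * bnorm a') (@cvg_axis j b cb))) (cvg0Z (C * bnorm a) hb))) => h.
  exact: nn.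
have -> : diff_quot psi j (a * b) h - (a' * b + a * b') =
   (diff_quot psi j a h - a') * psi (h *: e j) b + a' * (psi (h *: e j) b - b)
   + a * (diff_quot psi j b h - b').
  rewrite diff_quotM mulrBl !mulrBr opprD addrACA.
  by congr (_ + _); rewrite addrA subrK.
apply: le_trans (bnormD _ _) _; apply: lerD => //.
apply: le_trans (bnormD _ _) _; apply: lerD => //.
apply: le_trans (normM _ _) _.
by rewrite mulrAC ler_wpM2r ?nn// ler_wpM2l.
Qed.

(** Domination by two oscillations serves linear combinations, products and inverses alike. *)
Lemma cont_elt_le a b c (x y : R) : cont_elt psi b -> cont_elt psi c ->
  (forall t, bnorm (psi t a - a) <=
     x * bnorm (psi t b - b) + y * bnorm (psi t c - c)) ->
  cont_elt psi a.
Proof.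
move=> cb cc; pose F := nbhs (0 : 'rV[R]_d).
have FF : Filter F by exact: nbhs_filter.
move=> h; apply: (@cvg0_squeeze R _ F FF _ _ (fun t => nn _) h).
by apply: (@cvg0D R _ F FF); apply: (@cvg0Z R _ F FF).
Qed.

Lemma cont_eltZD (c : R[i]) a b : cont_elt psi a -> cont_elt psi b ->
  cont_elt psi (c *: a + b).
Proof.
move=> ca cb; apply: (@cont_elt_le _ a b (Normc.normc c) 1 ca cb) => t.
by rewrite linearP opprD addrACA -scalerBr -bnormZ mul1r bnormD.
Qed.

Lemma cont_elt1 : cont_elt psi 1.
Proof.
apply/cont_eltP => x x0; exists 1 => // t _.
by rewrite rmorph1 subrr bnorm0 ltW.
Qed.

Lemma cont_elt0 : cont_elt psi 0.
Proof.
apply/cont_eltP => x x0; exists 1 => // t _.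
by rewrite linear0 subrr bnorm0 ltW.
Qed.

Lemma cont_eltM a b : cont_elt psi a -> cont_elt psi b -> cont_elt psi (a * b).
Proof.
move=> ca cb.
apply: (@cont_elt_le _ a b (C * (M * bnorm b)) (C * bnorm a) ca cb) => t.
have -> : psi t (a * b) - a * b = (psi t a - a) * psi t b + a * (psi t b - b).
  by rewrite rmorphM mulrBl mulrBr addrA subrK.
apply: le_trans (bnormD _ _) _; apply: lerD => //.
apply: le_trans (normM _ _) _.
by rewrite mulrAC ler_wpM2r ?nn// ler_wpM2l.
Qed.

(** The uniform bound on the group makes approximation uniform over translates: replacing [l] by [a]
    changes the oscillation by at most [(M + 1) * bnorm (a - l)]. *)
Lemma cont_elt_closed (l : A) : (forall x : R, 0 < x ->
  exists2 a, cont_elt psi a & bnorm (a - l) <= x) -> cont_elt psi l.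
Proof.
move=> hl; apply/cont_eltP => x x0.
have M2 : 0 < M + 1 by rewrite ltr_wpDl.
have [|a /cont_eltP ca al] := hl (x / 2 / (M + 1)); first by rewrite !divr_gt0.
have [|r r0 hr] := ca (x / 2); first by rewrite divr_gt0.
exists r => // t /hr h.
have -> : psi t l - l = (psi t a - a) + ((a - l) - psi t (a - l)).
  rewrite linearB /= opprB !addrA subrK [RHS]addrC !addrA addNr add0r.
  exact: addrC.
apply: le_trans (bnormD _ _) _; rewrite [leRHS]splitr lerD//.
apply: le_trans (bnormB _ _) _.
apply: le_trans (lerD (lexx _) (psiM t _)) _.
rewrite -[X in X + _]mul1r -mulrDl [1 + M]addrC mulrC -ler_pdivlMr//.
Qed.

(* Telescoping over [n] steps of length [h / n] replaces the integral
   of [psi_s a'] over [0, h]. *)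
Lemma diff_quot_mean j a a' b h (x : R) : h != 0 -> is_gen psi j a a' ->
  (forall s, `|s| <= `|h| -> bnorm (psi (s *: e j) a' - b) <= x) ->
  bnorm (diff_quot psi j a h - b) <= x.
Proof.
move=> h0 /is_genP ha hx.
apply/ler_addgt0Pr => y y0.
have yM : 0 < y / M by rewrite divr_gt0// (lt_le_trans ltr01).
have [r r0 hr] := ha _ yM.
(* The step [h / n] must be shorter than [r], so that its quotient is within [y / M] of [a'];
   translating this error costs a factor [M]. *)
pose n := (Num.truncn (`|h| / r)).+1.
have n0 : 0 < n%:R :> R by rewrite ltr0n.
have nh : `|h| / r < n%:R by rewrite truncnS_gt.
pose s := h / n%:R.
have s0 : s != 0 by rewrite mulf_neq0// invr_eq0 gt_eqF.
have sr : `|s| < r.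
  rewrite normrM normfV (ger0_norm (ltW n0)) ltr_pdivrMr//.
  by rewrite mulrC -ltr_pdivrMr.
(* The quotient of step [h] is the average of the translates by [m * s], [m < n], of the quotient of
   step [s]. *)
have E : diff_quot psi j a h - b = (n%:R^-1)%:C *:
   \sum_(m < n) (psi ((m%:R * s) *: e j) (diff_quot psi j a s) - b).
  rewrite sumrB sumr_const card_ord scalerBr -[b *+ n]scaler_nat scalerA.
  have -> : (n%:R^-1)%:C * n%:R = 1 :> R[i].
    by rewrite -(rmorph_nat (@real_complex R)) -rmorphM /= mulVf ?rmorph1// gt_eqF.
  rewrite scale1r; congr (_ - _).
  under eq_bigr do rewrite linearZ /=.
  rewrite -scaler_sumr scalerA -rmorphM/= -invfM mulrC divfK ?gt_eqF//.
  rewrite /diff_quot; congr (_ *: _).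
  pose f m := psi ((m%:R * s) *: e j) a.
  rewrite (eq_bigr (fun m : 'I_n => f m.+1 - f m)) => [|m _].
    rewrite -(big_mkord xpredT (fun m => f m.+1 - f m)) telescope_sumr//.
    by rewrite /f mul0r scale0r psi0 /s mulrC divfK ?gt_eqF.
  by rewrite linearB /= psiD -scalerDl -{2}[s]mul1r -mulrDl natr1.
rewrite E bnormZr ger0_norm; last by rewrite invr_ge0 ltW.
rewrite mulrC ler_pdivrMr//.
apply: le_trans (bnorm_sum _ _ _) _.
rewrite -[n in n%:R]card_ord mulr_natr -sumr_const ler_sum// => m _.
have -> : psi ((m%:R * s) *: e j) (diff_quot psi j a s) - b =
  (psi ((m%:R * s) *: e j) a' - b) +
  psi ((m%:R * s) *: e j) (diff_quot psi j a s - a').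
  by rewrite linearB /= [RHS]addrC addrA subrK.
apply: le_trans (bnormD _ _) _; apply: lerD.
  apply: hx; rewrite /s mulrCA normrM ler_piMr// ger0_norm ?divr_ge0//.
  by rewrite ler_pdivrMr// mul1r ler_nat ltnW.
apply: le_trans (psiM _ _) _.
by rewrite mulrC -ler_pdivlMr ?(lt_le_trans ltr01)//; exact: hr.
Qed.

Lemma diff_quot_le j a h : bnorm (diff_quot psi j a h) <= `|h|^-1 * ((M + 1) * bnorm a).
Proof.
rewrite /diff_quot bnormZr normfV ler_wpM2l// mulrDl mul1r.
by apply: le_trans (bnormB _ _) _; rewrite lerD2r.
Qed.

(** The radius [r] comes from the continuity of [a'] alone. The index [n0] is chosen after [h], so
    the factor [|h|^-1] in front of [bnorm (u n - a)] is harmless, while the mean value inequality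
    controls the quotients of [u n0]. *)
Lemma is_gen_closed j (u v : nat -> A) a a' :
  (forall n, is_gen psi j (u n) (v n)) ->
  bnorm (u n - a) @[n --> \oo] --> (0 : R) ->
  bnorm (v n - a') @[n --> \oo] --> (0 : R) ->
  cont_elt psi a' -> is_gen psi j a a'.
Proof.
move=> huv hu hv /cont_eltP ca'; apply/is_genP => x x0.
have x2 : 0 < x / 2 by rewrite divr_gt0.
have [r r0 hr] := ca' _ x2; exists r => // h h0 hhr.
have g0 n : 0 <= M * bnorm (v n - a') + `|h|^-1 * (M + 1) * bnorm (u n - a).
  by rewrite addr_ge0// mulr_ge0 ?nn// mulr_ge0 ?invr_ge0// addr_ge0.
have [n0 _ /(_ n0 (leqnn _)) /= hn] := (cvg0_leP g0).1
  (cvg0D (cvg0Z M hv) (cvg0Z (`|h|^-1 * (M + 1)) hu)) _ x2.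
have -> : diff_quot psi j a h - a' =
    (diff_quot psi j (u n0) h - a') - diff_quot psi j (u n0 - a) h.
  by rewrite diff_quotB opprB [in RHS]addrC addrA subrK.
rewrite [leRHS]splitr.
apply: le_trans (bnormB _ _) _.
apply: (@le_trans _ _ (x / 2 + (M * bnorm (v n0 - a') +
   `|h|^-1 * (M + 1) * bnorm (u n0 - a)))); last by rewrite lerD2l.
rewrite addrA; apply: lerD; last by rewrite -mulrA diff_quot_le.
apply: (diff_quot_mean h0 (huv n0)) => s sh.
have -> : psi (s *: e j) (v n0) - a' =
    (psi (s *: e j) a' - a') + psi (s *: e j) (v n0 - a').
  by rewrite linearB /= [RHS]addrC addrA subrK.
apply: le_trans (bnormD _ _) _; apply: lerD => //.
by apply: hr; apply: le_lt_trans (norm_axis _ _) (le_lt_trans sh hhr).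
Qed.

Lemma is_gen_psi j t a a' : is_gen psi j a a' ->
  is_gen psi j (psi t a) (psi t a').
Proof.
move=> ha; apply: (cvg0_squeeze _ _ (cvg0Z M ha)) => h; first exact: nn.
by rewrite diff_quot_psi -linearB psiM.
Qed.

Lemma is_gen_diff_quot i j a a' s : is_gen psi j a a' ->
  is_gen psi j (diff_quot psi i a s) (diff_quot psi i a' s).
Proof.
by move=> ha; apply: is_genZ; apply: is_genB => //; exact: is_gen_psi.
Qed.

(** The steps [1 / (n + 1)] supply a sequence, the form of convergence that [is_gen_closed]
    takes. *)
Lemma is_gen_seq j a b : is_gen psi j a b ->
  bnorm (diff_quot psi j a n.+1%:R^-1 - b) @[n --> \oo] --> (0 : R).
Proof.
move=> /is_genP ha; apply/cvg0_leP => [n|x /ha[r r0 hr]]; first exact: nn.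
near=> n; apply: hr; first by rewrite invr_neq0// pnatr_eq0.
rewrite ger0_norm ?invr_ge0 ?ler0n//; near: n.
exact: (near_infty_natSinv_lt (PosNum r0)).
Unshelve. all: by end_near. Qed.

(* Closedness of [delta_j] along the difference quotients of [a] in direction [i]. *)
Lemma is_gen_comm i j a ai aj c : is_gen psi i a ai -> is_gen psi j a aj ->
  is_gen psi i aj c -> cont_elt psi c -> is_gen psi j ai c.
Proof.
move=> hi hj hc cc.
apply: (is_gen_closed _ (is_gen_seq hi) (is_gen_seq hc) cc) => n.
exact: is_gen_diff_quot.
Qed.

(* [gen_word] applies the last letter first and [mi_word] is nondecreasing, so
   after [delta_i] only the generators of index at most [i] are available;
   [m] bounds the indices that may still be applied. [P] constrains all the
   derivatives, and [B] those of order [k]. *)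
Fixpoint sorted_smooth (P B : set A) k (m : nat) : set A :=
  if k is k'.+1 then
    [set a | P a /\ forall i : 'I_d, (i <= m)%N ->
      gen_dom psi i a /\ sorted_smooth P B k' i (gen psi i a)]
  else B.

Fixpoint smooth (P B : set A) k : set A :=
  if k is k'.+1 then
    [set a | P a /\ forall i : 'I_d,
      gen_dom psi i a /\ smooth P B k' (gen psi i a)]
  else B.

(** * From sorted words of generators to arbitrary words *)

Section Smooth.
Context {P B : set A}.
Hypothesis BP : B `<=` P.
Hypothesis Pcont : P `<=` cont_elt psi.

Lemma sorted_smooth_base k m a : sorted_smooth P B k m a -> P a.
Proof. by case: k => [|k] /=; [exact: BP | case]. Qed.

(** After [delta_i], a generator [delta_j] with [j <= i] is available by definition. For [j > i]
    only [delta_i (delta_j a)] is given; the induction hypothesis at [delta_j a] shows that it is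
    smooth, hence continuous, and commutation identifies it with [delta_j (delta_i a)]. *)
Lemma sorted_smooth_gen k m a i : (i <= m)%N ->
  sorted_smooth P B k.+1 m a -> sorted_smooth P B k m (gen psi i a).
Proof.
elim: k m a i => [|k IH] m a i im ha; first by have [_ /(_ i im)[]] := ha.
have [Pa hD] := ha; have [di hi] := hD i im; split.
  exact: (sorted_smooth_base (k:=k.+1) hi).
move=> j jm; have [ji|/ltnW ij] := leqP j i; first exact: hi.2.
have [dj hj] := hD j jm; have [dij _] := hj.2 i ij.
have hc := IH _ _ _ ij hj.
have hji : is_gen psi j (gen psi i a) (gen psi i (gen psi j a)).
  apply: is_gen_comm (gen_domP di) (gen_domP dj) (gen_domP dij) _.
  exact/Pcont/sorted_smooth_base/hc.
by split; [exact: is_gen_dom hji | rewrite (is_gen_gen hji)].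
Qed.

(** The bound [d] exceeds every index, so it restricts nothing, and [sorted_smooth_gen] keeps it at
    [d] after each generator. *)
Lemma sorted_smooth_smooth k a : sorted_smooth P B k d a -> smooth P B k a.
Proof.
elim: k a => // k IH a h; split=> [|i]; first by case: h.
split; first by have [_ /(_ i (ltnW (ltn_ord i)))[]] := h.
by apply/IH/sorted_smooth_gen => //; exact: ltnW.
Qed.

Lemma smooth_base k a : smooth P B k a -> P a.
Proof. by case: k => [|k] /=; [exact: BP | case]. Qed.

Lemma gen_word_rcons w i a :
  gen_word psi (rcons w i) a = gen_word psi w (gen psi i a).
Proof. by rewrite /gen_word -cats1 foldr_cat. Qed.

(** [gen_word_dom] peels off the generator applied last, [smooth] the one applied first; this passes
    from one recursion to the other. *)
Lemma gen_word_dom_rcons w i a : gen_word_dom psi (rcons w i) a <->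
  [/\ cont_elt psi a, gen_dom psi i a & gen_word_dom psi w (gen psi i a)].
Proof.
elim: w => [|j w IH] /=; first by split => -[].
rewrite -/(gen_word psi _ _) gen_word_rcons.
split=> [[/IH[? ? ?] ? ?]|[? ? [? ? ?]]] //.
by split => //; exact/IH.
Qed.

Lemma smooth_word k w a : smooth P B k a -> (size w <= k)%N ->
  [/\ gen_word_dom psi w a, P (gen_word psi w a)
     & size w = k -> B (gen_word psi w a)].
Proof.
elim/last_ind: w k a => [|w i IH] [|k] a //= ha.
- by split=> //; [exact/Pcont/BP | exact: BP].
- by split=> //; [exact/Pcont/(smooth_base (k:=k.+1)) | exact: (smooth_base (k:=k.+1))].
- by rewrite size_rcons.
rewrite size_rcons ltnS => wk; have [Pa /(_ i)[di hi]] := ha.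
have [h1 h2 h3] := IH _ _ hi wk; rewrite gen_word_rcons; split=> //.
  by apply/gen_word_dom_rcons; split => //; exact: Pcont.
by case.
Qed.

(** Appending [i], the letter applied first, keeps a word sorted when all its letters are at most
    [i]: this is the bound that the recursion passes on. *)
Lemma word_sorted_smooth k m a :
  (forall w : seq 'I_d, pairwise (fun i j => i <= j)%N w ->
    all (fun i : 'I_d => (i <= m)%N) w ->
    (size w <= k)%N ->
    [/\ gen_word_dom psi w a, P (gen_word psi w a)
      & size w = k -> B (gen_word psi w a)]) ->
  sorted_smooth P B k m a.
Proof.
elim: k m a => [|k IH] m a h; first by have [_ _ /(_ erefl)] := h [::] isT isT isT.
split=> [|i im]; first by have [] := h [::] isT isT isT.
have [|/= [_ di _] _ _] := h [:: i] isT _ isT; first by rewrite /= im.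
split=> //; apply: IH => w sw wi wk.
have [|||] := h (rcons w i).
- by rewrite pairwise_rcons wi.
- rewrite all_rcons im /=; apply: sub_all wi => l /leq_trans; exact.
- by rewrite size_rcons.
- move=> /gen_word_dom_rcons[_ _ hw]; rewrite gen_word_rcons size_rcons => Pw Bw.
  by split=> // wk'; apply: Bw; rewrite wk'.
Qed.
End Smooth.

(** * Second differences and the Zygmund class *)

Lemma bnormM_le a b (x y : R) : bnorm a <= x -> bnorm b <= y ->
  bnorm (a * b) <= C * x * y.
Proof.
move=> ax by_; apply: le_trans (normM _ _) _.
by rewrite -!mulrA ler_wpM2l// ler_pM ?nn.
Qed.

Lemma psi_le t a (x : R) : bnorm a <= x -> bnorm (psi t a) <= M * x.
Proof. by move=> ax; apply: le_trans (psiM _ _) _; rewrite ler_wpM2l. Qed.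

Lemma Delta_le t a (x : R) : bnorm a <= x -> bnorm (Delta psi t a) <= (M + 1) * x.
Proof.
move=> ax; apply: le_trans (bnormB _ _) _; rewrite mulrDl mul1r.
by apply: lerD => //; exact: psi_le.
Qed.

Lemma DeltaZD t (c : R[i]) a b :
  Delta psi t (c *: a + b) = c *: Delta psi t a + Delta psi t b.
Proof. by rewrite /Delta linearP opprD addrACA -scalerBr. Qed.

Lemma DeltaD t a b : Delta psi t (a + b) = Delta psi t a + Delta psi t b.
Proof. by rewrite -[a]scale1r DeltaZD !scale1r. Qed.

Lemma Delta_psi t a : Delta psi t (psi t a) = psi t (Delta psi t a).
Proof. by rewrite /Delta linearB. Qed.

Lemma DeltaM t a b :
  Delta psi t (a * b) = Delta psi t a * psi t b + a * Delta psi t b.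
Proof. by rewrite /Delta rmorphM mulrBl mulrBr addrA subrK. Qed.

Lemma Delta0E a : Delta psi 0 a = 0.
Proof. by rewrite /Delta psi0 subrr. Qed.

Lemma Delta_1 t : Delta psi t 1 = 0.
Proof. by rewrite /Delta rmorph1 subrr. Qed.

Lemma Delta_0 t : Delta psi t 0 = 0.
Proof. by rewrite /Delta linear0 subrr. Qed.

Lemma Delta2M t a b : Delta psi t (Delta psi t (a * b)) =
  Delta psi t (Delta psi t a) * psi t (psi t b)
  + (Delta psi t a * psi t (Delta psi t b) + Delta psi t a * psi t (Delta psi t b))
  + a * Delta psi t (Delta psi t b).
Proof.
by rewrite DeltaM DeltaD !DeltaM Delta_psi !addrA.
Qed.

Lemma Delta_double t a : Delta psi t a + Delta psi t a =
  Delta psi (t + t) a - Delta psi t (Delta psi t a).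
Proof.
rewrite /Delta (linearB (psi t)) /= psiD !opprB [RHS]addrCA; congr (_ + _).
by rewrite [RHS]addrC addrA subrK.
Qed.

Lemma norm1_ge0 t : 0 <= norm1 t.
Proof. exact: sumr_ge0. Qed.

Lemma norm1_eq0 t : (norm1 t == 0) = (t == 0).
Proof.
apply/idP/eqP => [|->]; last by rewrite /norm1 big1// => j _; rewrite mxE normr0.
rewrite psumr_eq0// => /allP h; apply/rowP => j; rewrite mxE.
by apply/eqP; rewrite -normr_eq0; apply: (h j); rewrite mem_index_enum.
Qed.

Lemma norm1_double t : norm1 (t + t) = 2 * norm1 t.
Proof.
rewrite /norm1 mulr_sumr; apply: eq_bigr => j _.
by rewrite mxE -mulr2n normrMn mulr_natl.
Qed.

Section Zygmund.
Variable eta : R.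
Hypothesis eta0 : 0 < eta.
Hypothesis eta1 : eta <= 1.

Definition cont_ball (X : R) : set A := [set a | cont_elt psi a /\ bnorm a <= X].

(** The seminorm bound is multiplied out, which lets [t] range over all vectors; at [t = 0] the
    left-hand side vanishes. *)
Definition zyg_ball (X : R) : set A :=
  [set a | cont_ball X a /\
    forall t, bnorm (Delta psi t (Delta psi t a)) <= X * norm1 t `^ eta].

Definition hz_ball k (X : R) : set A := smooth (cont_ball X) (zyg_ball X) k.

Lemma norm1_powR_half t :
  norm1 t `^ eta = norm1 t `^ (eta / 2) * norm1 t `^ (eta / 2).
Proof.
rewrite -powRD -?splitr//; first by rewrite (gt_eqF eta0).
Qed.

(* Marchaud's inequality, from [2 D_t = D_{2t} - D_t^2]. *)
Lemma zyg_ball_Delta (X : R) a t : zyg_ball X a ->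
  bnorm (Delta psi t a) <= (M + 3) * X * norm1 t `^ (eta / 2).
Proof.
move=> [[_ aX] zX]; have X0 := le_trans (nn a) aX.
have large u : 1 <= norm1 u ->
    bnorm (Delta psi u a) <= (M + 3) * X * norm1 u `^ (eta / 2).
  move=> u1; apply: le_trans (Delta_le _ aX) _.
  rewrite -[leLHS]mulr1 ler_pM ?mulr_ge0 ?addr_ge0//.
    by rewrite ler_wpM2r// lerD2l ler1n.
  by rewrite -[leLHS](powRr0 (norm1 u)) ler_powR// divr_ge0// ltW.
(* Induction on the dyadic scale: below size 1, the estimate at [u + u], one scale coarser, is
   already known. *)
have step n u : 2^-1 ^+ n <= norm1 u ->
    bnorm (Delta psi u a) <= (M + 3) * X * norm1 u `^ (eta / 2).
  elim: n u => [|n IH] u; first by rewrite expr0; exact: large.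
  move=> hu; have [/large//|u1] := leP 1 (norm1 u).
  have /IH : 2^-1 ^+ n <= norm1 (u + u).
    by rewrite norm1_double mulrC -ler_pdivrMr// -exprSr.
  rewrite norm1_double powRM ?norm1_ge0//.
  have := zX u; rewrite norm1_powR_half.
  have z2 : (2 : R) `^ (eta / 2) * 2 `^ (eta / 2) <= 2.
    rewrite -powRD -?splitr; last by apply/implyP => _; rewrite pnatr_eq0.
    by rewrite ler1_powR// ler1n.
  have p1 : norm1 u `^ (eta / 2) <= 1.
    have e2 : 0 <= eta / 2 by rewrite divr_ge0// ltW.
    have := ge0_ler_powR e2 _ _ (ltW u1); rewrite powR1; apply.
      by rewrite nnegrE norm1_ge0.
    by rewrite nnegrE.
  have := bnormB (Delta psi (u + u) a) (Delta psi u (Delta psi u a)).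
  rewrite -Delta_double -mulr2n -scaler_nat -(rmorph_nat (@real_complex R)).
  rewrite bnormZr ger0_norm//.
  move: p1 z2 (powR_ge0 (norm1 u) (eta / 2)) (powR_ge0 (2 : R) (eta / 2)).
  move: (norm1 u `^ _) (2 `^ _) (bnorm _) (bnorm _) (bnorm _) => p z x1 x2 x3.
  move=> p1 z2 p0 z0 h1 h2 h3.
  (* Here [z = 2^(eta/2)] and [p = |u|^(eta/2) <= 1]. Half of [3/2 (M + 3) X p + X p] is at most
     [(M + 3) X p], since [M + 3 >= 4]. The exponent [eta/2] keeps [z] away from 2 even for
     [eta = 1]. *)
  have z32 : z <= 3 / 2 by nra.
  have hp : X * (p * p) <= X * p by rewrite ler_wpM2l// ler_piMr.
  have Xp : 0 <= X * p by rewrite mulr_ge0.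
  have hz : (M + 3) * X * (z * p) <= 3 / 2 * ((M + 3) * (X * p)).
    have -> : (M + 3) * X * (z * p) = z * ((M + 3) * (X * p)) by ring.
    by rewrite ler_wpM2r// mulr_ge0// addr_ge0.
  have hM : 4 * (X * p) <= (M + 3) * (X * p) by rewrite ler_wpM2r//; move: M1; lra.
  by rewrite -mulrA; lra.
have [->|t0] := eqVneq t 0.
  by rewrite Delta0E bnorm0 !mulr_ge0 ?powR_ge0// addr_ge0.
have nt0 : 0 < norm1 t by rewrite lt_def norm1_eq0 t0 norm1_ge0.
have [n hn] : exists n, 2^-1 ^+ n <= norm1 t.
  have [n _ /(_ n (leqnn n)) /= h] :
      \forall n \near \oo, (2^-1 : R) ^+ n <= norm1 t.
    have /cvgr0Pnorm_le/(_ _ nt0) : ((2^-1 : R) ^+ n) @[n --> \oo] --> (0 : R).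
      by apply: cvg_expr; rewrite ger0_norm ?invr_ge0// invf_lt1// ltr1n.
    by apply: filterS => n; rewrite ger0_norm// exprn_ge0// invr_ge0.
  by exists n.
exact: step hn.
Qed.


Lemma zyg_ballM : exists2 c : R, 0 <= c & forall X Y a b,
  zyg_ball X a -> zyg_ball Y b -> zyg_ball (c * X * Y) (a * b).
Proof.
pose K := M + 3; have K0 : 0 <= K by rewrite addr_ge0.
(* The three summands bound the three terms of [Delta2M]; the last one also covers the norm of the
   product. *)
exists (C * (M * M + 2 * (K * M * K) + 1)).
  by rewrite mulr_ge0// !addr_ge0// ?mulr_ge0.
move=> X Y a b za zb; have [[ca aX] zX] := za; have [[cb bY] zY] := zb.
have X0 := le_trans (nn a) aX; have Y0 := le_trans (nn b) bY.
have XY0 : 0 <= X * Y by rewrite mulr_ge0.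
split=> [|t].
  split; first exact: cont_eltM.
  apply: le_trans (bnormM_le aX bY) _.
  rewrite -!mulrA ler_wpM2l// ler_peMl// lerDr addr_ge0// ?mulr_ge0//.
rewrite Delta2M norm1_powR_half.
set p := _ `^ _; have p0 : 0 <= p by exact: powR_ge0.
have ha := zyg_ball_Delta t za; have hb := zyg_ball_Delta t zb.
have := zX t; have := zY t; rewrite norm1_powR_half -/p in ha hb * => h2b h2a.
have h1 := bnormM_le h2a (psi_le t (psi_le t bY)).
have h2 := bnormM_le ha (psi_le t hb).
have h3 := bnormM_le aX h2b.
apply: le_trans (bnormD _ _) _; apply: le_trans (lerD (bnormD _ _) (lexx _)) _.
apply: le_trans (lerD (lerD (lexx _) (bnormD _ _)) (lexx _)) _.
by apply: le_trans (lerD (lerD h1 (lerD h2 h2)) h3) _; rewrite -/K; lra.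
Qed.

Lemma zyg_ball_inv X a b : zyg_ball X a -> a * b = 1 -> b * a = 1 ->
  exists Y, zyg_ball Y b.
Proof.
move=> za ab ba; have [[ca aX] zX] := za.
(* This first-order identity yields both the continuity of [b] and the Marchaud-type bound on
   [D_t b], before [b] is known to be in the Zygmund class. *)
have Db t : Delta psi t b = - (psi t b * Delta psi t a * b).
  rewrite /Delta mulrBr -rmorphM ba rmorph1 mulrBl mul1r -mulrA ab mulr1.
  by rewrite opprB.
have X0 := le_trans (nn a) aX.
pose K := M + 3; have K0 : 0 <= K by rewrite addr_ge0.
pose L := C * (C * (M * bnorm b) * (K * X)) * bnorm b.
have L0 : 0 <= L by rewrite !mulr_ge0 ?nn.
pose Y := C * bnorm b *
   (C * X * (M * (M * bnorm b)) + 2 * (C * (K * X) * (M * L))).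
have Y0 : 0 <= Y.
  by rewrite mulr_ge0// ?mulr_ge0 ?nn// addr_ge0// !mulr_ge0 ?nn.
exists (bnorm b + Y); split.
  split; last by rewrite lerDl.
  apply: (@cont_elt_le _ a a (C * C * (M * bnorm b) * bnorm b) 0 ca ca) => t.
  rewrite mul0r addr0 -/(Delta psi t b) Db bnormN.
  apply: le_trans (normM _ _) _.
  rewrite [leRHS]mulrAC ler_wpM2r ?nn// -!mulrA ler_wpM2l// !mulrA.
  apply: le_trans (normM _ _) _.
  by rewrite ler_wpM2r ?nn// -mulrA ler_wpM2l.
move=> t; have Db_le : bnorm (Delta psi t b) <= L * norm1 t `^ (eta / 2).
  rewrite Db bnormN; have h := zyg_ball_Delta t za.
  have := bnormM_le (bnormM_le (psiM t b) h) (lexx (bnorm b)).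
  by move=> /le_trans; apply; rewrite /L -/K; lra.
have := Delta2M t a b; rewrite ab Delta_1 Delta_0 => /esym/eqP.
rewrite addrC addr_eq0 => /eqP E.
(* The product rule controls only [a * D_t^2 b]; multiplying by [b] on the left removes [a]. *)
have -> : Delta psi t (Delta psi t b) = b * (a * Delta psi t (Delta psi t b)).
  by rewrite mulrA ba mul1r.
rewrite E norm1_powR_half.
have := zyg_ball_Delta t za; have := zX t; rewrite norm1_powR_half -/K.
move: Db_le (powR_ge0 (norm1 t) (eta / 2)).
move: (norm1 t `^ _) => p hb p0 h2a ha.
have h1 := bnormM_le h2a (psi_le t (psi_le t (lexx (bnorm b)))).
have h2 := bnormM_le ha (psi_le t hb).
apply: (@le_trans _ _ (Y * (p * p))); last first.
  by rewrite ler_wpM2r ?mulr_ge0// lerDr nn.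
rewrite mulrN bnormN.
apply: le_trans (normM _ _) _.
apply: le_trans (ler_wpM2l _ (le_trans (bnormD _ _) (lerD h1
  (le_trans (bnormD _ _) (lerD h2 h2))))) _; first by rewrite mulr_ge0 ?nn.
by rewrite /Y; lra.
Qed.

(** * Hölder-Zygmund balls of order k + eta *)

Lemma zyg_ball_cont X : zyg_ball X `<=` cont_ball X.
Proof. by move=> a []. Qed.

Lemma cont_ball_cont X : cont_ball X `<=` cont_elt psi.
Proof. by move=> a []. Qed.

(** An existential derivative replaces the value chosen by [gen], so that the calculus of [is_gen]
    applies directly. *)
Lemma hz_ballS k X a : hz_ball k.+1 X a <-> cont_ball X a /\
  forall i, exists2 a', is_gen psi i a a' & hz_ball k X a'.
Proof.
split=> -[ca h]; split=> // i.
  by have [di hi] := h i; exists (gen psi i a); [exact: gen_domP|].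
have [a' gi hi] := h i; split; first exact: is_gen_dom gi.
by rewrite (is_gen_gen gi).
Qed.

Lemma hz_ball_base k X a : hz_ball k X a -> cont_ball X a.
Proof. exact: (smooth_base (@zyg_ball_cont X)). Qed.

Lemma cont_ballW X Y a : X <= Y -> cont_ball X a -> cont_ball Y a.
Proof. by move=> XY [ca /le_trans aX]; split=> //; exact: aX. Qed.

Lemma hz_ballW k X Y a : X <= Y -> hz_ball k X a -> hz_ball k Y a.
Proof.
move=> XY; elim: k a => [|k IH] a.
  move=> [/(cont_ballW XY) ca h]; split=> // t; apply: le_trans (h t) _.
  by rewrite ler_wpM2r// powR_ge0.
move=> /hz_ballS[/(cont_ballW XY) ca h]; apply/hz_ballS; split=> // i.
by have [a' ga /IH] := h i; exists a'.
Qed.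

Lemma hz_ballZD k (c : R[i]) X Y a b : hz_ball k X a -> hz_ball k Y b ->
  hz_ball k (Normc.normc c * X + Y) (c *: a + b).
Proof.
have cb a1 b1 : cont_ball X a1 -> cont_ball Y b1 ->
    cont_ball (Normc.normc c * X + Y) (c *: a1 + b1).
  move=> [ca aX] [cb bY]; split; first exact: cont_eltZD.
  apply: le_trans (bnormD _ _) _; rewrite bnormZ lerD//.
  by rewrite ler_wpM2l// normc_ge0.
elim: k a b => [|k IH] a b.
  move=> [ca ha] [cb' hb]; split=> [|t]; first exact: cb.
  rewrite !DeltaZD; apply: le_trans (bnormD _ _) _; rewrite mulrDl lerD//.
  by rewrite bnormZ -mulrA ler_wpM2l// normc_ge0.
move=> /hz_ballS[ca ha] /hz_ballS[cb' hb]; apply/hz_ballS; split=> [|i].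
  exact: cb.
have [a' ga za] := ha i; have [b' gb zb] := hb i.
by exists (c *: a' + b'); [exact: is_genZD | exact: IH].
Qed.

Lemma hz_ballD k X Y a b : hz_ball k X a -> hz_ball k Y b ->
  hz_ball k (X + Y) (a + b).
Proof.
by move=> ha /(hz_ballZD 1 ha); rewrite scale1r Normc.normc1 mul1r.
Qed.

Lemma hz_ballB k X Y a b : hz_ball k X a -> hz_ball k Y b ->
  hz_ball k (X + Y) (a - b).
Proof.
move=> ha hb; have := hz_ballZD (-1) hb ha.
have -> : -1 = (-1 : R)%:C :> R[i] by rewrite rmorphN1.
by rewrite normc_real normrN1 mul1r rmorphN1 scaleN1r [- b + a]addrC [Y + X]addrC.
Qed.

Lemma hz_ball0 k : hz_ball k 0 0.
Proof.
have cb : cont_ball 0 0 by split; [exact: cont_elt0 | rewrite bnorm0].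
elim: k => [|k IH]; first by split=> // t; rewrite !Delta_0 bnorm0 mul0r.
by apply/hz_ballS; split=> // i; exists 0 => //; exact: is_gen0.
Qed.

Lemma hz_ball1 k : hz_ball k (bnorm (1 : A)) 1.
Proof.
have cb : cont_ball (bnorm (1 : A)) 1 by split; [exact: cont_elt1|].
case: k => [|k].
  by split=> // t; rewrite Delta_1 Delta_0 bnorm0 mulr_ge0 ?nn ?powR_ge0.
apply/hz_ballS; split=> // i; exists 0; first exact: is_gen1.
by apply: hz_ballW (hz_ball0 k); exact: nn.
Qed.

(** This is the mean value inequality centred at 0. *)
Lemma Delta_axis_le i a a' h (X : R) : is_gen psi i a a' -> bnorm a' <= X ->
  bnorm (psi (h *: e i) a - a) <= `|h| * (M * X).
Proof.
move=> ga aX; have [->|h0] := eqVneq h 0.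
  by rewrite scale0r psi0 subrr bnorm0 normr0 mul0r.
have := @diff_quot_mean i a a' 0 h (M * X) h0 ga.
rewrite subr0 bnormZr normfV ler_pdivrMl ?normr_gt0//; apply.
by move=> s _; rewrite subr0 psi_le.
Qed.

(** The vector [t] is reached along one coordinate axis after another; the second factor [M] pays
    for translating each increment to its starting point. *)
Lemma Delta_norm1_le a t (X : R) :
  (forall i, exists2 a', is_gen psi i a a' & bnorm a' <= X) ->
  bnorm (Delta psi t a) <= M * (M * X) * norm1 t.
Proof.
move=> ha; rewrite /Delta /norm1 {1}[t]row_sum_delta.
elim/big_rec2: _ => [|i y s _ IH].
  by rewrite psi0 subrr bnorm0 mulr0.
rewrite [_ + s]addrC -psiD.
have -> : psi s (psi (t 0 i *: e i) a) - a =
    psi s (psi (t 0 i *: e i) a - a) + (psi s a - a).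
  by rewrite linearB /= addrA subrK.
rewrite mulrDr; apply: le_trans (bnormD _ _) (lerD _ IH).
have [a' ga aX] := ha i; rewrite -mulrA [M * X * _]mulrC.
exact/psi_le/(Delta_axis_le _ ga aX).
Qed.

(** Only [k = 0] has content: a differentiable element is Lipschitz, and [|t| <= |t|^eta] for
    [|t| <= 1]; for larger [t] boundedness suffices. *)
Lemma hz_ball_pred : exists2 c : R, 0 <= c & forall k X a,
  hz_ball k.+1 X a -> hz_ball k (c * X) a.
Proof.
(* Dominates both [(M + 1) * M * M], needed for small [t], and [(M + 1)^2], needed for large [t]. *)
pose c := (M + 1) * (M + 1) * (M * M).
have c1 : 1 <= c.
  rewrite /c -[leLHS]mulr1 ler_pM// -[leLHS]mulr1 ler_pM//.
    by rewrite lerDr.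
  by rewrite lerDr.
have c0 : 0 <= c := le_trans ler01 c1.
exists c => //.
move=> k X; elim: k => [|k IH] a /hz_ballS[ca ha].
  have [ca1 aX] := ca; have X0 := le_trans (nn a) aX.
  split=> [|t]; first by apply: cont_ballW ca; rewrite ler_peMl.
  have [t1|/ltW t1] := leP (norm1 t) 1.
    apply: (@le_trans _ _ ((M + 1) * (M * (M * X) * norm1 t))).
      apply/Delta_le/Delta_norm1_le => i; have [a' ga za] := ha i.
      by exists a' => //; exact: (hz_ball_base za).2.
    apply: (@le_trans _ _ (c * X * norm1 t)).
      have -> : c * X * norm1 t = (M + 1) * ((M + 1) * (M * (M * X) * norm1 t)).
        by rewrite /c; ring.
      by rewrite ler_peMl ?lerDr// mulr_ge0 ?addr_ge0// !mulr_ge0 ?norm1_ge0.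
    rewrite ler_wpM2l ?(mulr_ge0 c0 X0)//.
    have [->|t0] := eqVneq (norm1 t) 0; first exact: powR_ge0.
    by apply: ger1_powR => //; rewrite t1 lt_def t0 norm1_ge0.
  apply: (@le_trans _ _ ((M + 1) * ((M + 1) * X))).
    by apply/Delta_le/Delta_le.
  apply: (@le_trans _ _ (c * X)).
    rewrite mulrA ler_wpM2r// /c ler_peMr ?mulr_ge0 ?addr_ge0//.
    by rewrite -[leLHS]mulr1 ler_pM.
  rewrite ler_peMr// ?(mulr_ge0 c0 X0)//.
  by rewrite -[leLHS](powRr0 (norm1 t)) ler_powR// ltW.
have X0 : 0 <= X by apply: le_trans (nn a) ca.2.
apply/hz_ballS; split=> [|i]; first by apply: cont_ballW ca; rewrite ler_peMl.
by have [a' ga /IH] := ha i; exists a'.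
Qed.


Lemma cont_ball_ge0 X a : cont_ball X a -> 0 <= X.
Proof. by move=> [_]; exact/le_trans/nn. Qed.

Lemma hz_ball_ge0 k X a : hz_ball k X a -> 0 <= X.
Proof. by move=> /hz_ball_base/cont_ball_ge0. Qed.

Lemma hz_ballM k : exists2 c : R, 0 <= c & forall X Y a b,
  hz_ball k X a -> hz_ball k Y b -> hz_ball k (c * X * Y) (a * b).
Proof.
elim: k => [|k [c c0 IH]]; first exact: zyg_ballM.
have [c' c'0 hp] := hz_ball_pred.
(* [C] bounds the product itself; each of the two Leibniz terms costs [c] for a product at order [k]
   and [c'] for lowering the undifferentiated factor to that order. *)
exists (C + 2 * (c * c')); first by rewrite addr_ge0// !mulr_ge0.
move=> X Y a b ha hb.
have X0 := hz_ball_ge0 ha; have Y0 := hz_ball_ge0 hb.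
have [pa pb] := (hp _ _ _ ha, hp _ _ _ hb).
move: ha hb => /hz_ballS[[ca aX] ha] /hz_ballS[[cb bY] hb].
apply/hz_ballS; split=> [|i].
  split; first exact: cont_eltM.
  apply: le_trans (bnormM_le aX bY) _.
  by rewrite -!mulrA ler_wpM2r ?mulr_ge0// lerDl !mulr_ge0.
have [a' ga za] := ha i; have [b' gb zb] := hb i.
exists (a' * b + a * b'); first exact: is_genM.
apply: hz_ballW (hz_ballD (IH _ _ _ _ za pb) (IH _ _ _ _ pa zb)).
have -> : c * X * (c' * Y) + c * (c' * X) * Y = 2 * (c * c') * X * Y by ring.
by rewrite -!(mulrA _ X) ler_wpM2r ?mulr_ge0// lerDr.
Qed.

(** The identity [psi_h b - b = - psi_h b * (psi_h a - a) * b] is divided by [h]; continuity of [b]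
    lets [psi_h b] tend to [b]. *)
Lemma is_gen_inv i a a' b : cont_elt psi b -> is_gen psi i a a' ->
  a * b = 1 -> b * a = 1 -> is_gen psi i b (- (b * a' * b)).
Proof.
move=> cb ga ab ba.
have E h : diff_quot psi i b h = - (psi (h *: e i) b * diff_quot psi i a h * b).
  rewrite /diff_quot -scalerAr -scalerAl -scalerN; congr (_ *: _).
  rewrite mulrBr -rmorphM ba rmorph1 mulrBl mul1r -mulrA ab mulr1.
  by rewrite opprB.
apply: (cvg0_squeeze _ _ (cvg0D
  (cvg0Z (C * (C * bnorm a') * bnorm b) (@cvg_axis i b cb))
  (cvg0Z (C * (C * (M * bnorm b)) * bnorm b) ga))) => h; first exact: nn.
rewrite E opprK addrC.
have -> : b * a' * b - psi (h *: e i) b * diff_quot psi i a h * b =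
  - ((psi (h *: e i) b - b) * a' * b) -
    (psi (h *: e i) b * (diff_quot psi i a h - a')) * b.
  by rewrite !mulrBl mulrBr mulrBl !opprB addrA subrK.
apply: le_trans (bnormB _ _) _; rewrite bnormN; apply: lerD.
  have := bnormM_le (bnormM_le (lexx (bnorm (psi (h *: e i) b - b)))
    (lexx (bnorm a'))) (lexx (bnorm b)).
  by move=> /le_trans; apply; lra.
have := bnormM_le (bnormM_le (psiM (h *: e i) b)
  (lexx (bnorm (diff_quot psi i a h - a')))) (lexx (bnorm b)).
by move=> /le_trans; apply; lra.
Qed.

(** Bootstrapping: once [b] has order [k], so has its derivative [- (b * a' * b)], which raises [b]
    to order [k + 1]. *)
Lemma hz_ball_inv k X a b : hz_ball k X a -> a * b = 1 -> b * a = 1 ->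
  exists Y, hz_ball k Y b.
Proof.
move=> ha ab ba; elim: k X ha => [|k IH] X ha; first exact: (zyg_ball_inv ha).
have [c' _ hp] := hz_ball_pred; have [Y hb] := IH _ (hp _ _ _ ha).
have [c _ hM] := hz_ballM k; have [cb bY] := hz_ball_base hb.
have /hz_ballS[_ ha'] := ha.
pose Z := c * (c * Y * X) * Y.
exists (Num.max Y Z); apply/hz_ballS; split=> [|i].
  by split=> //; rewrite le_max bY.
have [a' ga za] := ha' i; exists (- (b * a' * b)).
  exact: is_gen_inv ga ab ba.
have := hz_ballB (hz_ball0 k) (hM _ _ _ _ (hM _ _ _ _ hb za) hb).
by rewrite sub0r add0r; apply: hz_ballW; rewrite le_max lexx orbT.
Qed.

(** * Completeness in terms of balls *)

Definition hz_cauchy k (u : nat -> A) : Prop := forall x : R, 0 < x ->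
  exists n0, forall m n, (n0 <= m)%N -> (n0 <= n)%N -> hz_ball k x (u m - u n).

Lemma hz_cauchy_lim k u : (forall n, cont_elt psi (u n)) -> hz_cauchy k u ->
  exists l, [/\ cont_elt psi l, bnorm (u n - l) @[n --> \oo] --> (0 : R)
    & forall x : R, 0 < x -> \forall n \near \oo, bnorm (u n - l) <= x].
Proof.
move=> cu hu; have [|l hl] := @bnorm_complete R A u.
  move=> x x0; have x2 : 0 < x / 2 by rewrite divr_gt0.
  have [n0 hn] := hu _ x2; exists n0 => m n /hn h /h /hz_ball_base[_ hx].
  by apply: le_lt_trans hx _; rewrite ltr_pdivrMr// ltr_pMr// ltr1n.
have hl0 : forall x : R, 0 < x -> \forall n \near \oo, bnorm (u n - l) <= x.
  by apply: (cvg0_leP _).1 hl => n; exact: nn.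
exists l; split=> //; apply: cont_elt_closed => y /hl0[n _ /(_ n (leqnn n)) /= h].
by exists (u n).
Qed.

(** By induction the derivatives converge in the scale of order [k], and closedness of the
    generators identifies their limits as the derivatives of [l]. *)
Lemma hz_ball_complete k u : (forall n, exists X, hz_ball k X (u n)) ->
  hz_cauchy k u ->
  exists l, forall x : R, 0 < x -> \forall n \near \oo, hz_ball k x (u n - l).
Proof.
elim: k u => [|k IH] u hu cu;
  have cu1 n : cont_elt psi (u n) by have [X /hz_ball_base[]] := hu n.
- have [l [cl hl hl0]] := hz_cauchy_lim cu1 cu.
  exists l => x x0; have [n0 hn] := cu _ x0.
  near=> n; split; [split|].
  + by rewrite -scaleN1r addrC; apply: cont_eltZD.
  + by near: n; exact: hl0.
  + move=> t; apply/ler_addgt0Pr => y y0.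
    have M2 : 0 < (M + 1) * (M + 1) by rewrite mulr_gt0// ltr_wpDl.
    (* Lower semicontinuity of the seminorm: for fixed [n] and [t], replacing [l] by a late [u m]
       costs at most [(M + 1)^2 * bnorm (u m - l)], which is arbitrarily small. *)
    have [m [hm um]] : exists m, (n0 <= m)%N /\
        bnorm (u m - l) <= y / ((M + 1) * (M + 1)).
      have [|n1 _ h] := hl0 (y / ((M + 1) * (M + 1))); first exact: divr_gt0.
      exists (maxn n0 n1); split; first exact: leq_maxl.
      by apply: h => /=; exact: leq_maxr.
    have -> : u n - l = (u n - u m) + (u m - l) by rewrite addrA subrK.
    rewrite (DeltaD t (u n - u m)) DeltaD; apply: le_trans (bnormD _ _) _; apply: lerD.
      by apply: (hn _ _ _ _).2 => //; near: n; exists n0.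
    apply: le_trans (Delta_le _ (Delta_le _ um)) _.
    by rewrite mulrA mulrC divfK// gt_eqF.
have [l [cl hl hl0]] := hz_cauchy_lim cu1 cu.
have gu i n : is_gen psi i (u n) (gen psi i (u n)).
  have [X /hz_ballS[_ /(_ i)[a' ga _]]] := hu n.
  by rewrite (is_gen_gen ga).
have hw i n : exists X, hz_ball k X (gen psi i (u n)).
  have [X /hz_ballS[_ /(_ i)[a' ga ha]]] := hu n.
  by exists X; rewrite (is_gen_gen ga).
have cw i : hz_cauchy k (fun n => gen psi i (u n)).
  move=> x /cu[n0 hn]; exists n0 => m n hm hn'.
  have /hz_ballS[_ /(_ i)[a' ga ha]] := hn _ _ hm hn'.
  by rewrite (is_gen_uniq (is_genB (gu i m) (gu i n)) ga).
have [v hv] := choice (fun i => IH _ (hw i) (cw i)).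
have gl i : is_gen psi i l (v i).
  have hvi : forall x : R, 0 < x ->
      \forall n \near \oo, bnorm (gen psi i (u n) - v i) <= x.
    by move=> x /(hv i); apply: filterS => n /hz_ball_base[].
  apply: is_gen_closed (gu i) hl _ _.
    by apply/cvg0_leP => // n; exact: nn.
  apply: cont_elt_closed => y /hvi[n _ /(_ n (leqnn n)) /= h].
  by exists (gen psi i (u n)) => //; have [X /hz_ball_base[]] := hw i n.
exists l => x x0.
(* There are finitely many generators, so one threshold serves them all. *)
have hall : \forall n \near \oo, forall i, hz_ball k x (gen psi i (u n) - v i).
  by apply: filter_forall => i; exact: hv.
near=> n; apply/hz_ballS; split; [split|].
- by rewrite -scaleN1r addrC; apply: cont_eltZD.
- by near: n; exact: hl0.
- move=> i; exists (gen psi i (u n) - v i); first exact: is_genB.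
  by move: i; near: n.
Unshelve. all: by end_near. Qed.

End Zygmund.

(** * Comparison with the norm of the Hölder-Zygmund space *)

Lemma size_mi_word (al : 'I_d -> nat) : size (mi_word al) = mi_abs al.
Proof.
rewrite /mi_word /mi_abs size_flatten /shape -map_comp sumnE big_map big_enum.
by apply: eq_bigr => j _ /=; rewrite size_nseq.
Qed.

Lemma count_mi_word (al : 'I_d -> nat) i : count_mem i (mi_word al) = al i.
Proof.
rewrite /mi_word count_flatten -map_comp sumnE big_map big_enum /=.
rewrite (bigD1 i)//= count_nseq /= eqxx mul1n big1 ?addn0// => j ji.
by rewrite count_nseq /= (negbTE ji) mul0n.
Qed.

Lemma pairwise_mi_word (al : 'I_d -> nat) :
  pairwise (fun i j : 'I_d => i <= j)%N (mi_word al).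
Proof.
have : pairwise (fun i j : 'I_d => i <= j)%N (enum 'I_d).
  have := iota_sorted 0 d; rewrite (sorted_pairwise leq_trans) -val_enum_ord.
  by rewrite pairwise_map.
rewrite /mi_word; elim: (enum _) => //= i s IH /andP[hi /IH hs].
rewrite pairwise_cat hs andbT; apply/andP; split.
  apply/allrelP => x y /nseqP[-> _] /flatten_mapP[j /(allP hi) ij].
  by move=> /nseqP[-> _].
by elim: (al i) => //= n ->; rewrite andbT; apply/allP => j /nseqP[-> _].
Qed.

(** A sorted word is determined by the multiplicities of its letters. *)
Lemma mi_word_count (w : seq 'I_d) :
  pairwise (fun i j => i <= j)%N w -> mi_word (fun i => count_mem i w) = w.
Proof.
move=> hw; apply: (pairwise_eq _ (pairwise_mi_word _) hw) => [i j|].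
  by move=> /anti_leq/val_inj.
by apply/allP => i _ /=; rewrite count_mi_word.
Qed.

(** Letter counts do not exceed the length, so [inord] never falls back to its default. *)
Lemma mi_val_inord k (w : seq 'I_d) : (size w <= k)%N ->
  mi_val [ffun i => inord (count_mem i w) : 'I_k.+1] = fun i => count_mem i w.
Proof.
move=> wk; apply/funext => i; rewrite /mi_val ffunE inordK// ltnS.
exact: leq_trans (count_size _ _) wk.
Qed.

Lemma gen_wordZD w (c : R[i]) a b :
  gen_word_dom psi w a -> gen_word_dom psi w b ->
  gen_word psi w (c *: a + b) = c *: gen_word psi w a + gen_word psi w b.
Proof.
elim: w => //= i w IH [da ga _] [db gb _].
rewrite -/(gen_word psi w _) IH//.
by apply: is_gen_gen; apply: is_genZD; exact: gen_domP.
Qed.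

Lemma zyg_seminorm_le (eta X : R) a :
  (zyg_seminorm psi eta a <= X%:E)%E <->
  (forall t, t != 0 ->
    bnorm (Delta psi t (Delta psi t a)) <= X * norm1 t `^ eta).
Proof.
have E t : t != 0 ->
    (bnorm (Delta psi t (Delta psi t a)) <= X * norm1 t `^ eta) =
    (norm1 t `^ (- eta) * bnorm (Delta psi t (Delta psi t a)) <= X).
  move=> t0; rewrite powRN ler_pdivrMl 1?[_ * X]mulrC//.
  by rewrite powR_gt0// lt_def norm1_eq0 t0 norm1_ge0.
split=> [h t t0|h].
  rewrite E// -lee_fin; apply: le_trans h; apply: ereal_sup_ubound.
  by exists t.
by apply: ge_ereal_sup => _ [t t0 <-]; rewrite lee_fin -E//; exact: h.
Qed.

Hypothesis d_gt0 : (0 < d)%N.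

(** A nonzero vector exists because [d > 0]; a supremum over the empty set would be [-oo]. *)
Lemma zyg_seminorm_ge0 (eta : R) a : (0 <= zyg_seminorm psi eta a)%E.
Proof.
have t0 : e (Ordinal d_gt0) != 0.
  apply/eqP => /matrixP/(_ 0 (Ordinal d_gt0))/eqP.
  by rewrite !mxE !eqxx oner_eq0.
apply: le_trans (ereal_sup_ubound _); last by exists (e (Ordinal d_gt0)).
by rewrite lee_fin mulr_ge0 ?powR_ge0 ?nn.
Qed.

(** * Equivalence of the balls with the Hölder-Zygmund norm *)

Section Lambda.
Variable r : R.
Let k := zyg_order r.
Let eta := zyg_frac r.
Let mi := {ffun 'I_d -> 'I_k.+1}.
Implicit Types al : mi.

Local Notation zyg al a := (zyg_seminorm psi eta (gen_mi psi (mi_val al) a)).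

Lemma zyg_ballP X a : zyg_ball eta X a <->
  cont_ball X a /\ (zyg_seminorm psi eta a <= X%:E)%E.
Proof.
split=> -[ca h]; split=> //; first by apply/zyg_seminorm_le => t _; exact: h.
move=> t; have [->|t0] := eqVneq t 0; last by move/zyg_seminorm_le: h; exact.
by rewrite !Delta0E bnorm0 mulr_ge0 ?powR_ge0// (cont_ball_ge0 ca).
Qed.

Lemma Ck_norm_ge0 a : 0 <= Ck_norm psi k a.
Proof. by apply: sumr_ge0 => al _; rewrite mulr_ge0 ?nn// invr_ge0. Qed.

(** All terms of the extended norm are nonnegative, so finiteness of the total passes to each
    seminorm. *)
Lemma Lambda_zyg_fin al a : Lambda psi r a -> mi_abs (mi_val al) == k ->
  zyg al a \is a fin_num.
Proof.
move=> [_ h] ak; rewrite ge0_fin_numE ?zyg_seminorm_ge0//.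
apply: le_lt_trans h; rewrite /Lambda_enorm (bigD1 al)//=.
rewrite addeCA leeDl// adde_ge0 ?lee_fin ?Ck_norm_ge0// sume_ge0// => j _.
exact: zyg_seminorm_ge0.
Qed.

Lemma Lambda_normE a : Lambda psi r a -> Lambda_norm psi r a =
  Ck_norm psi k a + \sum_(al : mi | mi_abs (mi_val al) == k) fine (zyg al a).
Proof.
move=> ha; rewrite /Lambda_norm /Lambda_enorm.
rewrite (eq_bigr (fun al : mi => (fine (zyg al a))%:E)) => [|al ak].
  by rewrite sumEFin -EFinD.
by rewrite fineK// Lambda_zyg_fin.
Qed.

Lemma Lambda_norm_ge0 a : Lambda psi r a -> 0 <= Lambda_norm psi r a.
Proof.
move=> ha; rewrite Lambda_normE// addr_ge0 ?Ck_norm_ge0// sumr_ge0// => al _.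
by rewrite fine_ge0// zyg_seminorm_ge0.
Qed.

Lemma Lambda_zyg_le al a : Lambda psi r a -> mi_abs (mi_val al) == k ->
  (zyg al a <= (Lambda_norm psi r a)%:E)%E.
Proof.
move=> ha ak; rewrite -[leLHS]fineK ?Lambda_zyg_fin// lee_fin Lambda_normE//.
rewrite (bigD1 al)//= addrCA lerDl addr_ge0 ?Ck_norm_ge0// sumr_ge0// => j _.
by rewrite fine_ge0// zyg_seminorm_ge0.
Qed.

Lemma Lambda_gen_le al a : Lambda psi r a -> (mi_abs (mi_val al) <= k)%N ->
  bnorm (gen_mi psi (mi_val al) a) <=
    (mi_fact (mi_val al))%:R * Lambda_norm psi r a.
Proof.
move=> ha ak; rewrite -ler_pdivrMl; last first.
  by rewrite ltr0n /mi_fact prodn_gt0// => j; exact: fact_gt0.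
rewrite Lambda_normE// /Ck_norm (bigD1 al)//= -addrA lerDl addr_ge0//.
  by apply: sumr_ge0 => j _; rewrite mulr_ge0 ?nn// invr_ge0.
by apply: sumr_ge0 => j _; rewrite fine_ge0// zyg_seminorm_ge0.
Qed.

Lemma Lambda_hz : exists2 K : R, 0 <= K & forall a, Lambda psi r a ->
  hz_ball eta k (K * Lambda_norm psi r a) a.
Proof.
(* The factorials undo the weights of [Ck_norm]; the summand 1 serves the unweighted seminorms. *)
pose K : R := 1 + \sum_(al : mi) (mi_fact (mi_val al))%:R.
have K1 : 1 <= K by rewrite lerDl sumr_ge0.
exists K => [|a ha]; first exact: le_trans K1.
have N0 := Lambda_norm_ge0 ha.
(* Multi-indices give information on sorted words only; commutation extends it to all words. *)
apply: (sorted_smooth_smooth (@zyg_ball_cont eta _) (@cont_ball_cont _)).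
apply: word_sorted_smooth => w sw _ wk.
pose al : mi := [ffun i => inord (count_mem i w)].
have wE : mi_word (mi_val al) = w by rewrite mi_val_inord// mi_word_count.
have ak : mi_abs (mi_val al) = size w by rewrite -size_mi_word wE.
have dw : gen_word_dom psi w a.
  by have := ha.1 (mi_val al); rewrite ak /gen_mi_dom wE; exact.
have cw : cont_ball (K * Lambda_norm psi r a) (gen_word psi w a).
  split; first by move: dw; case: (w) => [|i w'] //= [].
  have := @Lambda_gen_le al _ ha; rewrite ak /gen_mi wE => /(_ wk)/le_trans; apply.
  rewrite ler_wpM2r// /K (bigD1 al)//= addrCA lerDl addr_ge0//.
  exact: sumr_ge0.
split=> // wk'; apply/zyg_ballP; split=> //.
have := @Lambda_zyg_le al _ ha; rewrite ak wk' eqxx /gen_mi wE => /(_ isT).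
by move=> /le_trans; apply; rewrite lee_fin ler_peMl.
Qed.

Lemma hz_Lambda : exists2 K : R, 0 <= K & forall X a, hz_ball eta k X a ->
  Lambda psi r a /\ Lambda_norm psi r a <= K * X.
Proof.
(* One count of the multi-indices for the derivatives, whose weights are at most 1, and one for the
   seminorms. *)
pose K : R := #|mi|%:R; exists (K + K) => [|X a ha]; first by rewrite addr_ge0.
have X0 := hz_ball_ge0 ha.
have hw := smooth_word (@zyg_ball_cont eta X) (@cont_ball_cont X) ha.
have sumX (P : pred mi) : \sum_(al | P al) X <= K * X.
  rewrite sumr_const -mulr_natl ler_wpM2r// ler_nat; exact: max_card.
have hC : Ck_norm psi k a <= K * X.
  apply: le_trans (sumX _); apply: ler_sum => al ak.
  have [|_ [_ aX] _] := hw (mi_word (mi_val al)); first by rewrite size_mi_word.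
  apply: le_trans aX; rewrite ler_piMl ?nn// invf_le1 ?ler1n ?ltr0n.
    by rewrite prodn_gt0// => j; exact: fact_gt0.
  by rewrite prodn_gt0// => j; exact: fact_gt0.
have hZ al : mi_abs (mi_val al) == k -> (zyg al a <= X%:E)%E.
  move=> /eqP ak; have [|_ _] := hw (mi_word (mi_val al)).
    by rewrite size_mi_word ak.
  by rewrite size_mi_word => /(_ ak)/zyg_ballP[].
have hE : (Lambda_enorm psi r a <= ((K + K) * X)%:E)%E.
  rewrite mulrDl EFinD leeD ?lee_fin//.
  apply: le_trans (lee_sum _ hZ) _.
  by rewrite sumEFin lee_fin sumX.
have La : Lambda psi r a.
  split=> [al ak|]; last by rewrite (le_lt_trans hE) ?ltry.
  by have [|] := hw (mi_word al); first by rewrite size_mi_word.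
split=> //; rewrite -lee_fin; apply: le_trans hE.
rewrite /Lambda_norm fineK// ge0_fin_numE ?La.2//.
rewrite adde_ge0 ?lee_fin ?Ck_norm_ge0// sume_ge0// => al _.
exact: zyg_seminorm_ge0.
Qed.

(** Balls determine the norm only up to constants, so they give membership; the sharp inequality is
    proved term by term. *)
Lemma Lambda_normZD (c : R[i]) a b : Lambda psi r a -> Lambda psi r b ->
  Lambda psi r (c *: a + b) /\
  Lambda_norm psi r (c *: a + b) <=
    Normc.normc c * Lambda_norm psi r a + Lambda_norm psi r b.
Proof.
move=> ha hb.
have hab : Lambda psi r (c *: a + b).
  have [K _ LK] := Lambda_hz; have [K' _ KL] := hz_Lambda.
  exact: (KL _ _ (hz_ballZD c (LK _ ha) (LK _ hb))).1.
have gZD (al : mi) : (mi_abs (mi_val al) <= k)%N ->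
    gen_mi psi (mi_val al) (c *: a + b) =
    c *: gen_mi psi (mi_val al) a + gen_mi psi (mi_val al) b.
  by move=> ak; apply: gen_wordZD; [apply: ha.1 | apply: hb.1].
split=> //; rewrite !Lambda_normE// mulrDr addrACA lerD//.
  rewrite /Ck_norm mulr_sumr -big_split /=; apply: ler_sum => al ak.
  rewrite mulrCA -mulrDr ler_wpM2l ?invr_ge0// gZD//.
  by apply: le_trans (bnormD _ _) _; rewrite bnormZ.
rewrite mulr_sumr -big_split /=; apply: ler_sum => al ak.
rewrite -lee_fin fineK ?Lambda_zyg_fin//; apply/zyg_seminorm_le => t t0.
rewrite gZD ?(eqP ak)// !DeltaZD; apply: le_trans (bnormD _ _) _.
have le_fine x : Lambda psi r x -> bnorm (Delta psi t (Delta psi t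
    (gen_mi psi (mi_val al) x))) <= fine (zyg al x) * norm1 t `^ eta.
  move=> hx; apply: (zyg_seminorm_le _ _ _).1 t0.
  by rewrite fineK ?Lambda_zyg_fin.
rewrite mulrDl lerD//; last exact: le_fine.
by rewrite bnormZ -mulrA ler_wpM2l ?normc_ge0// le_fine.
Qed.

End Lambda.

End AutomorphismGroup.

(** * Banach algebra structure and inverse-closedness from the ball estimates *)

Theorem theorem3p21 (R : realType) (A : banachAlg R) (d : nat)
    (d_gt0 : (0 < d)%N) (psi : 'rV[R]_d -> {lrmorphism A -> A})
    (psi_grp : bounded_automorphism_group psi) (r : R) (r_gt0 : 0 < r) :
  banach_subalgebra (Lambda psi r) (Lambda_norm psi r) /\
  inverse_closed (Lambda psi r).
Proof.
have [psi_bij psiD [M0 psiM0]] := psi_grp.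
have psi_inj t : injective (psi t) by exact: bij_inj.
pose M := `|M0| + 1; have M1 : 1 <= M by rewrite lerDr.
have psiM t a : bnorm (psi t a) <= M * bnorm a.
  apply: le_trans (psiM0 t a) _; rewrite ler_wpM2r ?bnorm_ge0//.
  by rewrite (le_trans (ler_norm _))// lerDl.
have [C C1 normM] := @bnormM_ex R A.
have /andP[eta0 eta1] := zyg_frac_itv r_gt0.
pose k := zyg_order r; pose ball := hz_ball psi (zyg_frac r) k.
have [K K0 LK] : exists2 K : R, 0 <= K & forall a, Lambda psi r a ->
    ball (K * Lambda_norm psi r a) a.
  exact: (Lambda_hz psiD psi_inj M1 psiM d_gt0).
have [K' K'0 KL] : exists2 K : R, 0 <= K & forall X a, ball X a ->
    Lambda psi r a /\ Lambda_norm psi r a <= K * X.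
  exact: (hz_Lambda psiD psi_inj d_gt0).
have LZD := Lambda_normZD psiD psi_inj M1 psiM d_gt0 (r := r).
have [c c0 ballM] : exists2 c : R, 0 <= c & forall X Y a b,
    ball X a -> ball Y b -> ball (c * X * Y) (a * b).
  exact: (hz_ballM psiD psi_inj M1 psiM C1 normM eta0 eta1 k).
have N_ge0 a : Lambda psi r a -> 0 <= Lambda_norm psi r a.
  exact: Lambda_norm_ge0.
have embed a : Lambda psi r a -> bnorm a <= K * Lambda_norm psi r a.
  by move=> /LK/hz_ball_base[].
have [L0 N0] : Lambda psi r 0 /\ Lambda_norm psi r 0 = 0.
  have [L0 N0] := KL _ _ (hz_ball0 psi (zyg_frac r) k).
  by split=> //; apply/eqP; rewrite eq_le N_ge0// andbT -(mulr0 K').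
have NZ z a : Lambda psi r a -> Lambda psi r (z *: a) /\
    Lambda_norm psi r (z *: a) <= Normc.normc z * Lambda_norm psi r a.
  by move=> /LZD/(_ L0)-/(_ z); rewrite N0 !addr0.
have LM a b : Lambda psi r a -> Lambda psi r b -> Lambda psi r (a * b) /\
    Lambda_norm psi r (a * b) <=
      K' * c * K * K * Lambda_norm psi r a * Lambda_norm psi r b.
  move=> /LK ha /LK hb; have [hL hN] := KL _ _ (ballM _ _ _ _ ha hb).
  by split=> //; apply: le_trans hN _; lra.
split; last first.
  move=> a b /LK ha ab ba.
  have [Y /KL[]//] := hz_ball_inv psiD psi_inj M1 psiM C1 normM eta0 eta1 ha ab ba.
split; last by exists K.
  split=> [|z a b|a b]; rewrite !inE.
  - exact: (KL _ _ (hz_ball1 _ _ _)).1.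
  - by move=> ha hb; exact: (LZD _ _ _ ha hb).1.
  - by move=> ha hb; exact: (LM _ _ ha hb).1.
split; last by exists (K' * c * K * K) => a b ha hb; exact: (LM _ _ ha hb).2.
  split=> // [a ha Na|a b ha hb|z a ha].
  - by apply/bnorm_eq0/eqP; rewrite eq_le bnorm_ge0 -(mulr0 K) -Na embed.
  - by have := (LZD 1 _ _ ha hb).2; rewrite scale1r Normc.normc1 mul1r.
  have [ca Nca] := NZ z a ha; apply/eqP; rewrite eq_le Nca /=.
  have [->|z0] := eqVneq z 0; first by rewrite Normc.normc0 mul0r scale0r N0.
  (* The reverse inequality for [z] follows from the bound already known for [z^-1]. *)
  have zn : Normc.normc z * Normc.normc z^-1 = 1.
    by rewrite -Normc.normcM mulfV// Normc.normc1.
  have := (NZ z^-1 _ ca).2; rewrite scalerA mulVf// scale1r.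
  by move=> /(ler_wpM2l (normc_ge0 z)); rewrite mulrA zn mul1r.
(* The Cauchy property is transferred to balls; [K + 1] is a positive divisor even when [K = 0]. *)
move=> u hu cu; pose K1 := K + 1; have K1_gt0 : 0 < K1 by rewrite ltr_wpDl.
have [|x x0|l hl] := hz_ball_complete psiD psi_inj M1 psiM
  (eta := zyg_frac r) (k := k) (u := u).
- by move=> n; exists (K * Lambda_norm psi r (u n)); exact: LK.
- have [n0 hn] := cu (x / K1) (divr_gt0 x0 K1_gt0).
  exists n0 => m n hm hn'; have Lmn : Lambda psi r (u m - u n).
    by rewrite addrC -scaleN1r; exact: (LZD _ _ _ (hu n) (hu m)).1.
  apply: hz_ballW (LK _ Lmn); apply: (@le_trans _ _ (K * (x / K1))).
    by rewrite ler_wpM2l// ltW// hn.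
  by rewrite mulrCA ler_piMr ?ltW// ltr_pdivrMr// mul1r ltrDl.
have Lu : forall x : R, 0 < x -> \forall n \near \oo,
    Lambda psi r (u n - l) /\ Lambda_norm psi r (u n - l) <= K' * x.
  by move=> x /hl; apply: filterS => n /KL.
(* Convergence in balls puts some [u n - l] in the space, hence also [l]. *)
have Ll : Lambda psi r l.
  have [n _ /(_ n (leqnn n)) /= [h _]] := Lu 1 ltr01.
  have -> : l = -1 *: (u n - l) + u n by rewrite scaleN1r opprB subrK.
  exact: (LZD _ _ _ h (hu n)).1.
exists l => //.
have N0n n : 0 <= Lambda_norm psi r (u n - l).
  by apply: N_ge0; rewrite addrC -scaleN1r; exact: (LZD _ _ _ Ll (hu n)).1.
apply/(cvg0_leP N0n) => x x0.
have K'1 : 0 < K' + 1 by rewrite ltr_wpDl.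
have [n0 _ h] := Lu (x / (K' + 1)) (divr_gt0 x0 K'1).
exists n0 => // n /h [_ /le_trans]; apply.
by rewrite mulrCA ler_piMr ?ltW// ltr_pdivrMr// mul1r ltrDl.
Qed.
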